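(* Let $B$ be a stationary Bratteli diagram. Let $\mu$ be an ergodic infinite $\mathcal{R}$-invariant measure on $B$, and let $\mu_f$ be the corresponding finite measure. Then $\mu$ is good if and only if $\mu_f$ is good.
   Context: Stationary Bratteli diagrams. Let $F=(f_{ij})$ be a $K\times K$ matrix of non-negative integers without zero rows or columns. The stationary Bratteli diagram $B$ with incidence matrix $F$ has levels $V_0=\{v_0\}$ and, for $k\ge1$, $V_k$ a copy of $\{1,\dots,K\}$; there is one edge from $v_0$ to each vertex of $V_1$ and, for $k\ge1$, $f_{ij}$ edges from vertex $j$ of $V_k$ to vertex $i$ of $V_{k+1}$. $X_B$ is the space of infinite paths starting at $v_0$, with topology generated by the (clopen) cylinder sets of paths with a prescribed initial segment; a cylinder set given by a path of length $N$ from $v_0$ to $i\in V_N$ is said to end in the vertex $i$ on level $N$. The tail (cofinal) equivalence relation $\mathcal{R}$ on $X_B$ relates two paths if they coincide from some level on; it is assumed aperiodic (all classes infinite). A measure is $\mathcal{R}$-invariant if for any two finite paths $e,e'$ from $v_0$ to the same vertex, replacing the initial segment $e$ by $e'$ preserves the measure (so cylinders ending in the same vertex of the same level have equal measure); it is ergodic if every $\mathcal{R}$-invariant Borel set is null or has null complement. Vertex classes are the strongly connected components of the directed graph on $\{1,\dots,K\}$ with $j\to i$ iff $f_{ij}>0$; $\beta\prec\alpha$ means $\beta\ne\alpha$ and there is a directed path from $\beta$ to $\alpha$. Put $A=F^T$, and let $A_\alpha$ be its restriction to $\alpha$; non-zero $A_\alpha$ are primitive (achieved by telescoping). $X_\alpha$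 is the set of paths that eventually pass only through vertices of $\alpha$. The ergodic $\mathcal{R}$-invariant measures considered are the following: to a class $\alpha$ whose block has Perron–Frobenius eigenvalue $\lambda>1$ corresponds the $\mathcal{R}$-invariant measure $\mu$ (unique up to scaling) with $\mu(X_B\setminus X_\alpha)=0$ and measure $\xi_i/\lambda^{N-1}$ for each cylinder ending in $i\in\alpha$ on level $N$, where $A_\alpha\xi=\lambda\xi$, $\xi>0$. It is finite iff $\lambda$ exceeds the spectral radius of $A_\beta$ for all $\beta\prec\alpha$ ($\lambda$ distinguished), and infinite otherwise ($\lambda$ non-distinguished). Measures are considered only on their supports, so all vertices belong to $\alpha$ or to classes $\beta\prec\alpha$ and $\mu$ is full. For infinite $\mu$, let $B_f$ be the subdiagram whose vertices are those of $\alpha$ and of all $\beta\prec\alpha$ for which cylinders ending in $\beta$ have finite $\mu$-measure, with all edges of $B$ between them, and let $X_{B_f}$ be its path space (a clopen subset of $X_B$). Let $x$ be the positive vector with $A_fx=\lambda x$ ($A_f$ the transpose of the incidence matrix of $B_f$) and $\sum x_i=1$. The corresponding finite measure $\mu_f$ is the ergodic invariant probability measure on $X_{B_f}$ giving measure $x_i/\lambda^{N-1}$ to each cylinder of $B_f$ ending in vertex $i$ on level $N$; $\mu$ is normalized so that its restriction to $X_{B_f}$ is $\mu_f$. A full non-atomic measure (probability, or infinite with the set of points all of whose clopen neighbourhoods have infinite measure being null) on a Cantor space is good if for all clopen $U,V$ with measure of $U$ less than that of $V$ there is a clopen $W\subset V$ of the same measure as $U$. *)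

(* Defs.v *)
From HB Require Import structures.
From mathcomp Require Import all_boot all_order all_algebra.
From mathcomp Require Import all_classical all_reals all_analysis.

Set Implicit Arguments.
Unset Strict Implicit.
Unset Printing Implicit Defensive.

Import Order.TTheory GRing.Theory Num.Theory.

Local Open Scope classical_set_scope.
Local Open Scope ring_scope.

(** * Measures on topological spaces *)

(* Measurable types are pointed in the library, so the Borel measurable type
   of a space takes a base point. The sigma-algebra does not depend on it. *)
Definition borelType (T : topologicalType) (x0 : T) : Type := T.

Section Borel.
Variables (T : topologicalType) (x0 : T).
HB.instance Definition _ := Choice.on (borelType x0).
HB.instance Definition _ := isPointed.Build (borelType x0) x0.
HB.instance Definition _ :=
  @isMeasurable.Build (sigma_display (@open T)) (borelType x0)
    <<s @open T >>
    (@sigma_algebra0 _ setT (@open T))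
    (@sigma_algebraC (borelType x0) (@open T))
    (@sigma_algebra_bigcup _ setT (@open T)).
End Borel.

Definition borel_set (T : topologicalType) (A : set T) : Prop :=
  <<s @open T >> A.

Section Good.
Context {R : realType} {T : topologicalType}.
Implicit Type mu : set T -> \bar R.

Definition full_measure mu :=
  forall U : set T, open U -> U !=set0 -> (0 < mu U)%E.

Definition null_points mu := forall x : T, mu [set x] = 0%E.

Definition defective_set mu : set T :=
  [set x | forall U : set T, clopen U -> U x -> mu U = +oo%E].

Definition good mu :=
  [/\ full_measure mu,
      null_points mu,
      mu setT = 1%E \/ (mu setT = +oo%E /\ mu (defective_set mu) = 0%E) &
      forall U V : set T, clopen U -> clopen V -> (mu U < mu V)%E ->
        exists W : set T, [/\ clopen W, W `<=` V & mu W = mu U] ].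

End Good.

(** * Paths of a stationary Bratteli diagram *)

(* An edge [(m, i)] has range [i], and [m] numbers it among the parallel edges;
   its source is the range of the preceding edge. *)
Definition edge (K : nat) : Type := (nat * 'I_K)%type.

Definition follows (K : nat) (F : 'M[nat]_K) (d e : edge K) : bool :=
  (e.1 < F e.2 d.2)%N.

(* The edge [x k] joins level [k] to level [k.+1]. The single edges leaving
   v_0 are numbered 0. *)
Record bpath (K : nat) (F : 'M[nat]_K) : Type := BPath {
  bedge :> nat -> edge K;
  bpathP : (bedge 0%N).1 = 0%N /\ forall k, follows F (bedge k) (bedge k.+1)
}.

(* [s] is a finite path from v_0 to the vertex [i] on level [size s] >= 1. *)
Definition fpath_to (K : nat) (F : 'M[nat]_K) (s : seq (edge K)) (i : 'I_K) :
    bool :=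
  if s is e :: s' then
    [&& e.1 == 0%N, path (follows F) e s' & (last e s').2 == i]
  else false.

Definition cylinder (K : nat) (F : 'M[nat]_K) (s : seq (edge K)) :
    set (bpath F) :=
  [set x | mkseq x (size s) = s].
Arguments cylinder {K} F s _.

Section PathSpace.
Variables (K : nat) (F : 'M[nat]_K).

HB.instance Definition _ := gen_eqMixin (bpath F).
HB.instance Definition _ := gen_choiceMixin (bpath F).

(* The cylinder of the empty sequence is the whole space, and the cylinder of
   a sequence which is not a finite path is empty. *)
HB.instance Definition _ :=
  @isSubBaseTopological.Build (bpath F) (set (bpath F))
    (range (cylinder F)) id.

End PathSpace.

Definition tail_equiv (K : nat) (F : 'M[nat]_K) (x y : bpath F) : Prop :=
  exists n, forall k, (n <= k)%N -> x k = y k.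

Definition aperiodic (K : nat) (F : 'M[nat]_K) : Prop :=
  forall x : bpath F, infinite_set [set y | tail_equiv x y].

(* The image of [A], a set of paths starting with [s], under the replacement
   of [s] by a path [s'] of the same length and range. *)
Definition replace_prefix (K : nat) (F : 'M[nat]_K) (s s' : seq (edge K))
    (A : set (bpath F)) : set (bpath F) :=
  [set y | cylinder F s' y /\
           exists2 x, A x & forall k, (size s <= k)%N -> y k = x k].

Definition invariant_measure (R : realType) (K : nat) (F : 'M[nat]_K)
    (mu : set (bpath F) -> \bar R) : Prop :=
  forall (i : 'I_K) (s s' : seq (edge K)),
    fpath_to F s i -> fpath_to F s' i -> size s = size s' ->
    forall A : set (bpath F), borel_set A -> A `<=` cylinder F s ->
      mu (replace_prefix s s' A) = mu A.

Definition ergodic (R : realType) (K : nat) (F : 'M[nat]_K)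
    (mu : set (bpath F) -> \bar R) : Prop :=
  forall A : set (bpath F), borel_set A ->
    (forall x y, tail_equiv x y -> A x -> A y) ->
    mu A = 0%E \/ mu (~` A) = 0%E.

(** * Vertex classes *)

Section Classes.
Variables (K : nat) (F : 'M[nat]_K).

Definition arrow : rel 'I_K := fun j i => (0 < F i j)%N.

Definition vclasses : {set {set 'I_K}} :=
  equivalence_partition
    (fun i j => connect arrow i j && connect arrow j i) [set: 'I_K].

Definition class_prec (b a : {set 'I_K}) : bool :=
  (b != a) && [exists i in b, exists j in a, connect arrow i j].

(* The incidence matrix of the subdiagram with vertex set [S]. *)
Definition restrict_mx (S : {set 'I_K}) : 'M[nat]_#|S| :=
  mxsub (@enum_val _ (mem S)) (@enum_val _ (mem S)) F.

(* Paths eventually in [a]. *)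
Definition class_paths (a : {set 'I_K}) : set (bpath F) :=
  [set x | exists n, forall k, (n <= k)%N -> (x k).2 \in a].

End Classes.
Arguments class_paths {K} F a _.

Definition primitive_mx (n : nat) (A : 'M[nat]_n) : Prop :=
  exists2 p : nat, (0 < p)%N & forall i j, (0 < (A ^+ p) i j)%N.

Definition stationary_diagram (K : nat) (F : 'M[nat]_K) : Prop :=
  [/\ forall i, exists j, F i j != 0%N,
      forall j, exists i, F i j != 0%N,
      aperiodic F &
      forall b, b \in vclasses F -> (restrict_mx F b)^T != 0 ->
        primitive_mx (restrict_mx F b)^T].

(* For irreducible [A], the only eigenvalue with a positive eigenvector is the
   Perron-Frobenius eigenvalue. *)
Definition perron_pair (R : realType) (n : nat) (A : 'M[nat]_n)
    (lambda : R) (xi : 'cV[R]_n) : Prop :=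
  (forall i, 0 < xi i 0) /\
  map_mx (fun m : nat => m%:R : R) A *m xi = lambda *: xi.

(* The measure associated with a class [a] with Perron-Frobenius eigenvalue
   [lambda > 1], up to scaling. *)
Definition class_measure (R : realType) (K : nat) (F : 'M[nat]_K)
    (a : {set 'I_K}) (lambda : R) (mu : set (bpath F) -> \bar R) : Prop :=
  [/\ a \in vclasses F,
      1 < lambda,
      invariant_measure mu,
      mu (~` class_paths F a) = 0%E &
      exists2 xi : 'cV[R]_#|a|,
        perron_pair (restrict_mx F a)^T lambda xi &
        forall (i : 'I_#|a|) s, fpath_to F s (enum_val i) ->
          mu (cylinder F s) = (xi i 0 / lambda ^+ (size s).-1)%:E ].

(** * The finite subdiagram *)

Definition finite_class (R : realType) (K : nat) (F : 'M[nat]_K)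
    (mu : set (bpath F) -> \bar R) (b : {set 'I_K}) : Prop :=
  forall i s, i \in b -> fpath_to F s i -> (mu (cylinder F s) < +oo)%E.

Definition Bf_vertices (R : realType) (K : nat) (F : 'M[nat]_K)
    (a : {set 'I_K}) (mu : set (bpath F) -> \bar R) : {set 'I_K} :=
  a :|: \bigcup_(b in vclasses F | class_prec F b a && `[< finite_class mu b >]) b.

(* The inclusion of the path space of the subdiagram on [S]. *)
Section Inclusion.
Variables (K : nat) (F : 'M[nat]_K) (S : {set 'I_K}).

Definition incl_edge (e : edge #|S|) : edge K := (e.1, enum_val e.2).

Lemma incl_subproof (x : bpath (restrict_mx F S)) :
  (incl_edge (x 0%N)).1 = 0%N /\
  forall k, follows F (incl_edge (x k)) (incl_edge (x k.+1)).
Proof.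
have [x0 xS] := bpathP x; split=> // k.
by have := xS k; rewrite /follows mxE.
Qed.

Definition subdiagram_incl (x : bpath (restrict_mx F S)) : bpath F :=
  BPath (incl_subproof x).

End Inclusion.

(* [muf] is the finite measure, on the path space of the subdiagram on [S],
   determined by the normalized eigenvector [x]. *)
Definition finite_measure_of (R : realType) (K : nat) (F : 'M[nat]_K)
    (S : {set 'I_K}) (lambda : R) (x : 'cV[R]_#|S|)
    (muf : set (bpath (restrict_mx F S)) -> \bar R) : Prop :=
  [/\ perron_pair (restrict_mx F S)^T lambda x,
      \sum_i x i 0 = 1,
      invariant_measure muf,
      ergodic muf &
      forall i s, fpath_to (restrict_mx F S) s i ->
        muf (cylinder (restrict_mx F S) s) =
          (x i 0 / lambda ^+ (size s).-1)%:E ].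

(* Main.v *)
Require Import Defs.
From mathcomp Require Import all_boot all_order all_algebra.
From mathcomp Require Import all_classical all_reals all_analysis.
From mathcomp Require Import finmap zify lra.

(* If [mu] is good, so is its restriction to the clopen set [X_Bf]. Conversely,
   let [U] and [V] be clopen with [mu U < mu V]. A cylinder of finite measure
   ends in a vertex of [Bf]; after enough further levels its extensions end in
   vertices which paths of [Bf] also reach on the same level, so by invariance
   [mu U] is a finite sum of [muf]-measures of clopen sets. Since [mu] lives on
   the paths eventually in [a], and [a] is never left, [V] contains a finite
   union of cylinders ending in [a] of measure greater than [mu U]; each of
   them is carried measure-preservingly onto a cylinder of [X_Bf]. As [muf] is
   good, any such sum smaller than the measure of one of these cylinders is
   realised by a clopen subset of it. For the union, the sum is cut into small
   pieces which are distributed over the cylinders. *)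

Set Implicit Arguments.
Unset Strict Implicit.
Unset Printing Implicit Defensive.

Import Order.TTheory GRing.Theory Num.Theory.

Local Open Scope classical_set_scope.
Local Open Scope ring_scope.

(** * Splicing and extending infinite paths *)

Section Paths.
Variables (K : nat) (F : 'M[nat]_K).
Implicit Types (x y z : bpath F) (e : edge K) (A B : set (bpath F)).

Lemma bpath_ext x y : (forall k, x k = y k) -> x = y.
Proof.
case: x y => [x hx] [y hy] /= /funext exy.
by case: y / exy hy => hy; rewrite (Prop_irrelevance hx hy).
Qed.

Lemma glue_subproof x n (f : nat -> edge K) :
  follows F (x n) (f 0%N) -> (forall k, follows F (f k) (f k.+1)) ->
  let g k := if (k <= n)%N then x k else f (k - n.+1)%N in
  (g 0%N).1 = 0%N /\ forall k, follows F (g k) (g k.+1).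
Proof.
move=> h0 hS g; have [x0 xS] := bpathP x; split=> [//|k]; rewrite /g.
have [kn|nk|->] := ltngtP k n; first by rewrite xS.
  by rewrite subSS -(subnSK nk); apply: hS.
by rewrite subnn.
Qed.

Definition glue x n f h0 hS : bpath F := BPath (@glue_subproof x n f h0 hS).

Lemma shift_follows x m k : follows F (x (m + k)%N) (x (m + k.+1)%N).
Proof. by rewrite addnS; have [_] := bpathP x; apply. Qed.

(** The edges allowed after a vertex do not depend on its level, so [x] and [y] may meet on
    different levels [n.+1] and [m.+1]. *)
Lemma splice x n y m : (x n).2 = (y m).2 ->
  exists z, (forall k, (k <= n)%N -> z k = x k) /\
            (forall k, (0 < k)%N -> z (n + k)%N = y (m + k)%N).
Proof.
move=> exy.
have h0 : follows F (x n) (y (m.+1 + 0)%N).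
  by rewrite /follows exy addn0; have [_] := bpathP y; apply.
exists (glue h0 (shift_follows y m.+1)); split=> k hk /=; first by rewrite hk.
by rewrite ifF; [congr (y _)|]; lia.
Qed.

(** A diagram with equal levels lets a path be restarted: the first [m.+1] edges collapse into the
    single edge from [v_0] to the vertex they end in. *)
Lemma splice_start y m :
  exists z, (z 0%N).2 = (y m).2 /\ forall k, (0 < k)%N -> z k = y (m + k)%N.
Proof.
pose g k := if k is 0%N then (0%N, (y m).2) else y (m + k)%N.
have hg : (g 0%N).1 = 0%N /\ forall k, follows F (g k) (g k.+1).
  split=> // -[|k] /=; last exact: shift_follows.
  by have := shift_follows y m 0%N; rewrite addn0.
by exists (BPath hg); split=> // -[].
Qed.

Hypothesis F_out : forall j, exists i, F i j != 0%N.

Lemma infinite_walk e :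
  exists f : nat -> edge K, f 0%N = e /\ forall k, follows F (f k) (f k.+1).
Proof.
pose nx (d : edge K) : edge K := (0%N, projT1 (cid (F_out d.2))).
exists (fun k => iter k nx e); split=> // k.
by rewrite /follows /= lt0n; case: cid.
Qed.

Lemma bpath_step x n e : follows F (x n) e ->
  exists y, (forall k, (k <= n)%N -> y k = x k) /\ y n.+1 = e.
Proof.
move=> xe; have [f [f0 fS]] := infinite_walk e.
have h0 : follows F (x n) (f 0%N) by rewrite f0.
exists (glue h0 fS); split=> [k /= ->//|/=].
by rewrite ltnn subnn.
Qed.

Lemma bpath_connect x n j : connect (arrow F) (x n).2 j ->
  exists y m, (forall k, (k <= n)%N -> y k = x k) /\ (y (n + m)%N).2 = j.
Proof.
case/connectP=> p; elim: p x n => [|i p IHp] x n /=.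
  by move=> _ ->; exists x, 0%N; rewrite addn0.
case/andP=> xi ip jp; have [y [yx yi]] := @bpath_step x n (0%N, i) xi.
have [||z [m [zy zj]]] := IHp y n.+1; rewrite ?yi //.
exists z, m.+1; split=> [k kn|]; last by rewrite addnS -addSn.
by rewrite zy ?yx // ltnW.
Qed.

(** As no column of [F] is zero, finite paths never get stuck. Cylinders of finite paths can thus be
    handled as cylinders around infinite paths. *)
Lemma fpath_bpath s i : fpath_to F s i ->
  exists x n, s = mkseq x n.+1 /\ (x n).2 = i.
Proof.
case: s => // e s /and3P[/eqP e0 + /eqP <-] {i}.
elim/last_ind: s => [_|s d IHs].
  have [f [f0 fS]] := infinite_walk e.
  have hf : (f 0%N).1 = 0%N /\ forall k, follows F (f k) (f k.+1) by rewrite f0.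
  by exists (BPath hf), 0%N; rewrite /mkseq /= f0.
rewrite rcons_path => /andP[/IHs [x [n [esx xn]]] sd].
have ed : last e s = x n.
  by rewrite -[last e s]/(last e (e :: s)) esx mkseqS last_rcons.
have [|y [yx yd]] := @bpath_step x n d; first by rewrite -ed.
exists y, n.+1; split; last by rewrite last_rcons yd.
rewrite mkseqS -rcons_cons esx yd; congr rcons.
by apply/eq_in_map => k; rewrite mem_iota => /andP[_ kn]; rewrite yx.
Qed.

End Paths.

(** * The topology of the path space in terms of initial segments *)

Section Cylinders.
Variables (K : nat) (F : 'M[nat]_K).
Implicit Types (x y z : bpath F) (e : edge K) (A B : set (bpath F)).

(** Naming a cylinder by one of its points makes it non-empty and its prefix automatically a valid
    path. *)
Definition pcyl x n : set (bpath F) :=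
  [set y | forall k, (k < n)%N -> y k = x k].

Lemma cylinder_mkseq x n : cylinder F (mkseq x n) = pcyl x n.
Proof.
apply/seteqP; split=> y; rewrite /cylinder /pcyl /= size_mkseq.
  by move=> eyx k kn; rewrite -(nth_mkseq (x 0%N) y kn) eyx nth_mkseq.
move=> eyx; apply/eq_in_map => k; rewrite mem_iota => /andP[_ kn].
exact: eyx.
Qed.

Lemma cylinder_pcyl s y : cylinder F s y -> cylinder F s = pcyl y (size s).
Proof. by move=> <-; rewrite cylinder_mkseq size_mkseq. Qed.

Lemma fpath_mkseq x n : fpath_to F (mkseq x n.+1) (x n).2.
Proof.
have [x0 xS] := bpathP x; rewrite /fpath_to /mkseq /= x0 eqxx /=.
have -> : last (x 0%N) (map x (iota 1 n)) = x n.
  by rewrite -[LHS]/(last (x 0%N) (mkseq x n.+1)) mkseqS last_rcons.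
rewrite eqxx andbT.
apply/(pathP (x 0%N)) => i; rewrite size_map size_iota => hi.
rewrite (nth_map 0%N) ?size_iota // nth_iota // add1n.
case: i hi => [|i] hi //=.
by rewrite (nth_map 0%N) ?size_iota 1?ltnW // nth_iota 1?ltnW.
Qed.

Lemma pcyl_refl x n : pcyl x n x. Proof. by []. Qed.

Lemma pcyl_sub x m n : (m <= n)%N -> pcyl x n `<=` pcyl x m.
Proof. by move=> mn y xy k km; apply: xy; apply: leq_trans mn. Qed.

Lemma pcyl_eq x y n : pcyl x n y -> pcyl y n = pcyl x n.
Proof.
move=> xy; apply/seteqP; split=> z hz k kn; first by rewrite (hz k kn) xy.
by rewrite (hz k kn) -xy.
Qed.

Lemma open_pcyl x n : open (pcyl x n).
Proof.
rewrite -cylinder_mkseq.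
exists [set cylinder F (mkseq x n)]; last by rewrite bigcup_set1.
move=> _ ->; exists [fset cylinder F (mkseq x n)]%fset.
  by move=> A; rewrite inE => /eqP ->; apply/mem_set; exists (mkseq x n).
by rewrite set_fset1 bigcap_set1.
Qed.

Lemma open_pcylP A : open A <-> forall x, A x -> exists n, pcyl x n `<=` A.
Proof.
split=> [[D hD <-] x [C DC Cx]|hA].
  have [S hS eC] := hD C DC; move: Cx; rewrite -eC => hx.
  (* A basic open set is a finite intersection of cylinders; the sets containing a cylinder around
     [x] form a filter, hence are closed under such intersections. *)
  pose G : set (set (bpath F)) := [set A | exists n, pcyl x n `<=` A].
  have GF : Filter G.
    split; first by exists 0%N.
      move=> P Q [m hm] [n hn]; exists (maxn m n) => y hy; split.
        by apply/hm/(pcyl_sub _ hy)/leq_maxl.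
      by apply/hn/(pcyl_sub _ hy)/leq_maxr.
    by move=> P Q PQ [n hn]; exists n; apply: subset_trans PQ.
  have [n hn] : G (\bigcap_(i in [set` S]) i).
    apply: filter_bigI => i iS; have [s _ es] := set_mem (hS _ iS).
    by exists (size s); have := hx i iS; rewrite -es => /cylinder_pcyl <-.
  by exists n => y hy; exists C; rewrite // -eC; apply: hn.
rewrite (_ : A = \bigcup_(p in [set p : bpath F * nat | pcyl p.1 p.2 `<=` A])
  pcyl p.1 p.2); first by apply: bigcup_open => p _; apply: open_pcyl.
apply/seteqP; split=> [x Ax|x [p hp]]; last exact: hp.
by have [n hn] := hA x Ax; exists (x, n).
Qed.

(** Equivalently, [A] is a union of cylinders of length [n]. *)
Definition determined n A := forall x, A x -> pcyl x n `<=` A.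

Lemma determined_leq m n A : (m <= n)%N -> determined m A -> determined n A.
Proof. by move=> mn hA x Ax y /(pcyl_sub mn); apply: hA. Qed.

Lemma determined_pcyl x n : determined n (pcyl x n).
Proof. by move=> y /pcyl_eq ->. Qed.

Lemma determined_setC n A : determined n A -> determined n (~` A).
Proof. by move=> hA x Ax y xy Ay; apply/Ax/(hA y Ay) => k /xy ->. Qed.

Lemma determined_setI n A B :
  determined n A -> determined n B -> determined n (A `&` B).
Proof. by move=> hA hB x [Ax Bx] y xy; split; [apply: hA xy|apply: hB xy]. Qed.

Lemma determined_clopen n A : determined n A -> clopen A.
Proof.
move=> hA; split; first by apply/open_pcylP => x Ax; exists n; apply: hA.
rewrite -openC; apply/open_pcylP => x Ax; exists n.
exact: (determined_setC hA).
Qed.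

Lemma clopen_pcyl x n : clopen (pcyl x n).
Proof. exact/determined_clopen/determined_pcyl. Qed.

(** A finite alphabet for all paths. The successor on the maximum ensures that 0, the number of the
    edges leaving [v_0], is always listed. *)
Definition edge_seq : seq (edge K) :=
  [seq (m, i) | i <- enum 'I_K,
                m <- iota 0 (\max_(p : 'I_K * 'I_K) F p.1 p.2).+1].

Lemma edge_seqP x k : x k \in edge_seq.
Proof.
have [x0 xS] := bpathP x; apply/allpairsP; exists ((x k).2, (x k).1).
split; [by rewrite mem_enum| |by case: (x k)].
rewrite mem_iota add0n [_.1]/=.
case: k => [|k]; first by rewrite x0.
rewrite ltnS; apply: leq_trans (ltnW (xS k)) _.
exact: (leq_bigmax ((x k.+1).2, (x k).2)).
Qed.
End Cylinders.

(** * Clopen sets as finite disjoint unions of cylinders *)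

Section Clopen.
Variables (K : nat) (F : 'M[nat]_K).
Implicit Types (x y z : bpath F) (e : edge K) (A B : set (bpath F)).
Implicit Type P : set (bpath F) -> Prop.

Lemma edge_ind P A n : P set0 ->
    (forall B C, B `&` C = set0 -> P B -> P C -> P (B `|` C)) ->
    (forall e, P (A `&` [set y | y n = e])) ->
  P A.
Proof.
move=> P0 PU Pe.
have -> : A = A `&` [set y | y n \in undup (edge_seq F)].
  apply/seteqP; split=> [y Ay|y []//].
  by split; rewrite //= mem_undup edge_seqP.
have := undup_uniq (edge_seq F); elim: (undup _) => [_|e l IHl /= /andP[el ul]].
  rewrite (_ : _ `&` _ = set0) //.
  by apply/seteqP; split=> // y [].
rewrite (_ : _ `&` _ =
  (A `&` [set y | y n = e]) `|` (A `&` [set y | y n \in l])).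
  apply: PU => //; last exact: IHl.
  by apply/seteqP; split=> // y [[_ /= ->] [_ /=]]; apply/negP.
rewrite -setIUr; congr (_ `&` _); apply/seteqP; split=> y /=.
  by rewrite inE => /orP[/eqP|]; [left|right].
by rewrite inE => -[->|->]; rewrite ?eqxx ?orbT.
Qed.

Lemma pcyl_edge x n e A :
  A `&` pcyl x n `&` [set y | y n = e] = set0 \/
  exists2 y, A y /\ pcyl x n y &
    A `&` pcyl x n `&` [set y | y n = e] = A `&` pcyl y n.+1.
Proof.
have [->|/set0P[y [[Ay xy] /= yn]]] :=
  eqVneq (A `&` pcyl x n `&` [set y | y n = e]) set0; first by left.
right; exists y => //; rewrite -setIA; congr (_ `&` _).
apply/seteqP; split=> [z [xz /= zn] k|z yz].
  rewrite ltnS leq_eqVlt => /orP[/eqP ->|kn]; first by rewrite zn.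
  by rewrite (xz k kn) -(xy k kn).
split=> [k kn|]; last by rewrite /= (yz n).
by rewrite yz ?xy// ltnW.
Qed.

(** The alphabet is finite, so [A] is a finite disjoint union of cylinders of length [n]; properties
    stable under disjoint union need only be checked on these. *)
Lemma determined_ind P A n : determined n A -> P set0 ->
    (forall B C, B `&` C = set0 -> P B -> P C -> P (B `|` C)) ->
    (forall x, A x -> P (pcyl x n)) ->
  P A.
Proof.
move=> An P0 PU Pn.
(* Induction on the number [d] of levels still to be split; [m = 0] gives all of [A]. *)
suff H d : forall m x, (m + d = n)%N -> P (A `&` pcyl x m).
  have [->//|/set0P[x Ax]] := eqVneq A set0.
  have := H n 0%N x erefl; rewrite (_ : pcyl x 0 = setT) ?setIT //.
  by apply/seteqP; split.
elim: d => [|d IHd] m x emn.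
  have [->//|/set0P[y [Ay xy]]] := eqVneq (A `&` pcyl x m) set0.
  rewrite addn0 in emn; rewrite emn in xy *.
  rewrite (_ : A `&` _ = pcyl y n); first exact: Pn.
  rewrite -(pcyl_eq xy); apply/seteqP; split=> [z []//|z yz].
  by split=> //; apply: An yz.
apply: (@edge_ind _ _ m) => // e.
have [->//|[y _ ->]] := pcyl_edge x m e A.
by apply: IHd; rewrite addSnnS.
Qed.

(** König's lemma. If [A] is not determined by any level, some infinite path has only cylinders on
    which [A] stays undetermined; but a small cylinder around that path lies in [A] or in its
    complement. *)
Lemma clopen_determined A : clopen A -> exists n, determined n A.
Proof.
move=> [/open_pcylP oA]; rewrite -openC => /open_pcylP oC; apply: contrapT.
move=> /forallNP ndA.
pose bad n x := forall N, ~ determined N (A `&` pcyl x n).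
have step n x : bad n x -> exists y, pcyl x n y /\ bad n.+1 y.
  move=> bx; apply: contrapT => /forallNP H.
  suff [N] : exists N, determined N (A `&` pcyl x n) by apply: bx.
  apply: (@edge_ind (fun B => exists N, determined N B) _ n).
  - by exists 0%N.
  - move=> B C _ [M BM] [N CN]; exists (maxn M N) => y By z yz.
    have [yzM yzN] : pcyl y M z /\ pcyl y N z.
      by split; apply: pcyl_sub yz; [apply: leq_maxl|apply: leq_maxr].
    by case: By => [/BM|/CN]; [left|right]; auto.
  - move=> e; have [->|[y [_ xy] ->]] := pcyl_edge x n e A; first by exists 0%N.
    by have /not_andP[//|/existsNP[N /contrapT ?]] := H y; exists N.
have [x0 _] : exists x, A x.
  by apply: contrapT => /forallNP H; apply: (ndA 0%N) => x /H.
pose next n x := xget x [set y | pcyl x n y /\ bad n.+1 y].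
pose u := fix u n := if n is m.+1 then next m (u m) else x0.
have ubad n : bad n (u n).
  elim: n => [|n IHn] /=; last first.
    by rewrite /next; case: xgetP => [y _ []//|H]; have [y /H] := step _ _ IHn.
  move=> N; rewrite (_ : pcyl x0 0 = setT) ?setIT //.
  by apply/seteqP; split.
have uS n : pcyl (u n) n (u n.+1).
  rewrite /= /next; case: xgetP => [y _ []//|H].
  by have [y /H] := step _ _ (ubad n).
have uD n d : pcyl (u n) n (u (n + d)%N).
  elim: d => [|d IHd]; first by rewrite addn0.
  rewrite addnS => k kn; rewrite uS ?IHd //; exact: leq_trans kn (leq_addr _ _).
(* The diagonal path: [u k.+1] has settled its first [k.+1] edges, and later terms keep them. *)
pose g k := u k.+1 k.
have hg : (g 0%N).1 = 0%N /\ forall k, follows F (g k) (g k.+1).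
  split=> [|k]; first by have [] := bpathP (u 1%N).
  by rewrite /g -(uS k.+1 k (ltnSn k)); have [_] := bpathP (u k.+2); apply.
pose z := BPath hg.
have uz n : pcyl (u n) n z.
  by move=> k kn; rewrite /= /g -(uD k.+1 (n - k.+1)%N) // subnKC.
have [Az|Az] := pselect (A z).
  have [n zn] := oA z Az; apply: (ubad n n); rewrite -(pcyl_eq (uz n)).
  by rewrite setIC setIidl //; apply: determined_pcyl.
have [n zn] := oC z Az; apply: (ubad n n); rewrite -(pcyl_eq (uz n)).
by move=> y [Ay /zn].
Qed.

End Clopen.

(** * Borel sets and measures on them *)

Section BorelMeasure.
Variable T : topologicalType.
Implicit Types A B : set T.

Lemma borel_open A : open A -> borel_set A.
Proof. exact: sub_sigma_algebra. Qed.

Lemma borel_clopen A : clopen A -> borel_set A.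
Proof. by case=> /borel_open. Qed.

Lemma borel_setC A : borel_set A -> borel_set (~` A).
Proof. by move=> hA; rewrite -setTD; apply: sigma_algebraCD. Qed.

Lemma borel_closed A : closed A -> borel_set A.
Proof. by rewrite -openC -{2}[A]setCK => /borel_open/borel_setC. Qed.

Lemma borel_bigcup (A : nat -> set T) :
  (forall n, borel_set (A n)) -> borel_set (\bigcup_n A n).
Proof. exact: sigma_algebra_bigcup. Qed.

Lemma borel_setU A B : borel_set A -> borel_set B -> borel_set (A `|` B).
Proof.
move=> hA hB; rewrite -bigcup2E; apply: borel_bigcup => -[|[|n]] //=.
exact: sigma_algebra0.
Qed.

Lemma borel_setI A B : borel_set A -> borel_set B -> borel_set (A `&` B).
Proof.
move=> hA hB; rewrite -[_ `&` _]setCK setCI.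
exact: borel_setC (borel_setU (borel_setC hA) (borel_setC hB)).
Qed.

Variables (x0 : T) (R : realType) (mu : {measure set (borelType x0) -> \bar R}).

Lemma borel_measureU A B : borel_set A -> borel_set B -> A `&` B = set0 ->
  mu (A `|` B) = (mu A + mu B)%E.
Proof. by move=> hA hB; exact: (measureU mu). Qed.

Lemma borel_measure_le A B : borel_set A -> borel_set B -> A `<=` B ->
  (mu A <= mu B)%E.
Proof. by move=> hA hB; apply: (le_measure mu); apply/mem_set. Qed.

Lemma borel_measure_null A B : borel_set A -> borel_set B -> A `<=` B ->
  mu B = 0%E -> mu A = 0%E.
Proof.
move=> hA hB AB B0; apply/eqP; rewrite eq_le measure_ge0 andbT -B0.
exact: borel_measure_le.
Qed.

Lemma borel_measure_bigcup_le (A : nat -> set T) (c : \bar R) :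
    (forall n, borel_set (A n)) -> (forall n, A n `<=` A n.+1) ->
    (forall n, mu (A n) <= c)%E ->
  (mu (\bigcup_n A n) <= c)%E.
Proof.
move=> hA AS Ac.
have ndA : nondecreasing_seq (A : (set T)^nat).
  by apply/nondecreasing_seqP => n; apply/subsetPset.
have := @nondecreasing_cvg_mu _ (borelType x0) R mu A hA (borel_bigcup hA) ndA.
move=> cA; rewrite -(cvg_lim _ cA) //; apply: lime_le; first exact: cvgP cA.
exact: nearW.
Qed.

End BorelMeasure.

(** * The path space of a subdiagram which paths do not leave *)

Section Subdiagram.
Variables (K : nat) (F : 'M[nat]_K) (S : {set 'I_K}).
Implicit Types (x : bpath F) (y z : bpath (restrict_mx F S)).

Local Notation incl := (@subdiagram_incl K F S).

Lemma incl_edge_inj : injective (@incl_edge K S).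
Proof. by move=> [m i] [n j] [-> /enum_val_inj ->]. Qed.

Lemma incl_inj : injective incl.
Proof.
move=> y z eyz; apply: bpath_ext => k; apply: incl_edge_inj.
exact: (congr1 (fun x : bpath F => x k) eyz).
Qed.

Lemma incl_vertex y n : (incl y n).2 \in S.
Proof. exact: enum_valP. Qed.

Lemma incl_preimage_determined n (A : set (bpath F)) :
  determined n A -> determined n (incl @^-1` A).
Proof.
move=> hA y Ay z yz; apply: hA Ay _ _ => k kn.
by rewrite /= yz.
Qed.

Lemma incl_preimage_clopen (A : set (bpath F)) :
  clopen A -> clopen (incl @^-1` A).
Proof.
move=> /clopen_determined[n hA]; apply: (@determined_clopen _ _ n).
exact: incl_preimage_determined.
Qed.

Hypothesis S_forward : forall x n, (x n).2 \in S -> (x n.+1).2 \in S.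

(** Since [S] is never left, the first vertex alone decides whether a path belongs to the
    subdiagram. *)
Lemma incl_lift x : (x 0%N).2 \in S -> exists y, incl y = x.
Proof.
move=> x0S; have xS n : (x n).2 \in S by elim: n => // n; apply: S_forward.
pose f n : edge #|S| := ((x n).1, enum_rank_in x0S (x n).2).
have hf : (f 0%N).1 = 0%N /\ forall k, follows (restrict_mx F S) (f k) (f k.+1).
  have [hx0 hxS] := bpathP x; split=> // k.
  by rewrite /follows mxE !enum_rankK_in //; apply: hxS.
exists (BPath hf); apply: bpath_ext => k.
by rewrite /= /incl_edge /= enum_rankK_in // -surjective_pairing.
Qed.

Lemma incl_pcyl y n : incl @` pcyl y n.+1 = pcyl (incl y) n.+1.
Proof.
apply/seteqP; split=> [_ [z yz <-] k kn|x xy]; first by rewrite /= yz.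
have [|z ez] := @incl_lift x; first by rewrite xy // incl_vertex.
exists z => // k kn; apply: incl_edge_inj.
by move: (xy k kn); rewrite -ez.
Qed.

(** One more level is needed when [n = 0]: the image of the whole space is cut out by the condition
    that the first vertex lies in [S]. *)
Lemma incl_determined n (A : set (bpath (restrict_mx F S))) :
  determined n A -> determined n.+1 (incl @` A).
Proof.
move=> /(determined_leq (leqnSn n)) hA _ [y Ay <-].
by rewrite -incl_pcyl; apply/image_subset/hA.
Qed.

Lemma incl_clopen (A : set (bpath (restrict_mx F S))) :
  clopen A -> clopen (incl @` A).
Proof.
move=> /clopen_determined[n hA]; apply: (@determined_clopen _ _ n.+1).
exact: incl_determined.
Qed.

Lemma incl_open (A : set (bpath (restrict_mx F S))) :
  open A -> open (incl @` A).
Proof.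
move=> /open_pcylP hA; apply/open_pcylP => _ [y Ay <-].
have [n yA] := hA y Ay; exists n.+1; rewrite -incl_pcyl.
by apply: image_subset; apply: subset_trans yA; apply: pcyl_sub.
Qed.

(* The sets of vertices which paths of the subdiagram reach on level [n.+1]
   decrease with [n], hence stabilise; a path which has spent long enough in
   [S] visits vertices of their limit. *)
Lemma subdiagram_reach : exists n0, forall x k m n,
  (n0 <= m)%N -> (x k).2 \in S -> exists y, (incl y n).2 = (x (k + m)%N).2.
Proof.
pose V n := finset (fun i : 'I_K => `[< exists y, (incl y n).2 = i >]).

have VP n i : reflect (exists y, (incl y n).2 = i) (i \in V n).
  by rewrite inE; apply: asboolP.
have Vdecr m n : (m <= n)%N -> V n \subset V m.
  move=> mn; apply/fintype.subsetP => i /VP[y yi]; apply/VP.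
  (* Restarting [y] after [n - m] levels brings the same vertex down to level [m.+1]. *)
  have [z [z0 zS]] := splice_start y (n - m); exists z; rewrite -yi.
  case: m mn z0 zS => [|m] mn z0 zS; first by rewrite /= z0 subn0.
  by rewrite /= zS // subnK.
(* A decreasing sequence of finite sets is constant from a term of least cardinality on. *)
have [n0 hn0] : exists n0, forall m, (#|V n0| <= #|V m|)%N.
  have ex : exists c, `[< exists n, #|V n| = c >].
    by exists #|V 0%N|; apply/asboolP; exists 0%N.
  case: (ex_minnP ex) => c /asboolP[n0 hn0] cmin; exists n0 => m.
  by rewrite hn0; apply: cmin; apply/asboolP; exists m.
have Vlim n : V n0 \subset V n.
  have [/Vdecr//|/ltnW/Vdecr sub] := leqP n n0.
  by rewrite (_ : V n = V n0) //; apply/eqP; rewrite eqEcard sub hn0.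
exists n0 => x k m n n0m xkS.
have [z [z0 zS]] := splice_start x k.
have [|y ey] := @incl_lift z; first by rewrite z0.
apply/VP/(fintype.subsetP (Vlim n)).
apply/(fintype.subsetP (Vdecr _ _ n0m))/VP; exists y.
rewrite ey; case: m {n0m} => [|m]; first by rewrite addn0.
by rewrite zS.
Qed.

End Subdiagram.

(** * Invariance as transport of clopen sets between cylinders *)

Section Transport.
Variables (K : nat) (F : 'M[nat]_K).
Implicit Types (x y z : bpath F) (A : set (bpath F)).

Lemma replace_prefixE x y n A :
  replace_prefix (mkseq y n.+1) (mkseq x n.+1) A =
  [set z | pcyl x n.+1 z /\ exists2 w, A w & forall k, (n < k)%N -> z k = w k].
Proof. by rewrite /replace_prefix !size_mkseq cylinder_mkseq. Qed.

Lemma replace_prefix_pcyl x y n : (x n).2 = (y n).2 ->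
  replace_prefix (mkseq y n.+1) (mkseq x n.+1) (pcyl y n.+1) = pcyl x n.+1.
Proof.
move=> exy; rewrite replace_prefixE; apply/seteqP; split=> [z []//|z xz].
split=> //; have [|w [wy wz]] := @splice _ _ y n z n; first by rewrite xz.
exists w; first by move=> k; rewrite ltnS => /wy.
by move=> k nk; rewrite -(subnKC (ltnW nk)) wz // subn_gt0.
Qed.

Lemma replace_prefix_clopen x y n A : (x n).2 = (y n).2 ->
  A `<=` pcyl y n.+1 -> clopen A ->
  clopen (replace_prefix (mkseq y n.+1) (mkseq x n.+1) A).
Proof.
move=> exy Ay /clopen_determined[m hA]; rewrite replace_prefixE.
apply: (@determined_clopen _ _ (maxn m n.+1)) => z [xz [w Aw zw]] z' zz'.
have zz'n : pcyl z n.+1 z' by apply: pcyl_sub zz'; apply: leq_maxr.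
have xz' : pcyl x n.+1 z' by rewrite -(pcyl_eq xz).
(* Putting the prefix of [y] back in front of the tail of [z'] gives the preimage of [z']; it agrees
   with [w] on the first [m] edges, hence lies in [A]. *)
split=> //; have [|w' [w'y w'z]] := @splice _ _ y n z' n; first by rewrite xz'.
have w'z' k : (n < k)%N -> w' k = z' k.
  by move=> nk; rewrite -(subnKC (ltnW nk)) w'z // subn_gt0.
exists w' => [|k nk]; last by rewrite w'z'.
apply: (hA w Aw) => k km; have [kn|nk] := leqP k n.
  by rewrite w'y // (Ay w Aw).
by rewrite w'z' // zz' ?zw // leq_max km.
Qed.

Variables (R : realType) (mu : set (bpath F) -> \bar R).
Hypothesis mu_inv : invariant_measure mu.

Lemma invariant_transport x y n A : (x n).2 = (y n).2 ->
    A `<=` pcyl y n.+1 -> clopen A ->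
  exists W, [/\ clopen W, W `<=` pcyl x n.+1 & mu W = mu A].
Proof.
move=> exy Ay hA.
exists (replace_prefix (mkseq y n.+1) (mkseq x n.+1) A); split.
- exact: replace_prefix_clopen.
- by rewrite replace_prefixE => z [].
- apply: (mu_inv (fpath_mkseq y n)); rewrite ?size_mkseq //.
  + by rewrite -exy; apply: fpath_mkseq.
  + exact: borel_clopen.
  + by rewrite cylinder_mkseq.
Qed.

Lemma invariant_pcyl x y n : (x n).2 = (y n).2 ->
  mu (pcyl x n.+1) = mu (pcyl y n.+1).
Proof.
move=> exy; rewrite -(replace_prefix_pcyl exy).
apply: (mu_inv (fpath_mkseq y n)); rewrite ?size_mkseq ?cylinder_mkseq //.
  by rewrite -exy; apply: fpath_mkseq.
exact: borel_clopen (clopen_pcyl y n.+1).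
Qed.

End Transport.

(** * Vertex classes, and why the class [a] is never left *)

Section VertexClasses.
Variables (K : nat) (F : 'M[nat]_K).

Let strong i j := connect (arrow F) i j && connect (arrow F) j i.

Let strong_equiv : {in [set: 'I_K]%SET & &, equivalence_rel strong}.
Proof.
move=> i j k _ _ _; split; first by rewrite /strong !connect0.
case/andP=> ij ji; apply/andP/andP => -[ik ki].
  by split; apply: connect_trans; eassumption.
by split; apply: connect_trans; eassumption.
Qed.

Lemma mem_vclass b i j : b \in vclasses F -> i \in b ->
  (j \in b) = connect (arrow F) i j && connect (arrow F) j i.
Proof.
move=> bV ib.
have /and3P[_ tV _] := equivalence_partitionP strong_equiv.
rewrite -(def_pblock tV bV ib).
by rewrite (pblock_equivalence_partition strong_equiv) ?finset.in_setT.
Qed.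

Lemma vclass_exists i : exists2 b, b \in vclasses F & i \in b.
Proof.
have /and3P[/eqP cV tV _] := equivalence_partitionP strong_equiv.
have iV : i \in finset.cover (vclasses F) by rewrite cV finset.in_setT.
exists (finset.pblock (vclasses F) i).
  exact: finset.pblock_mem.
by rewrite finset.mem_pblock.
Qed.

Variable a : {set 'I_K}.
Hypothesis aV : a \in vclasses F.
Hypothesis support : forall b, b \in vclasses F -> b = a \/ class_prec F b a.

Lemma connect_to_class i : exists2 j, j \in a & connect (arrow F) i j.
Proof.
have [b bV ib] := vclass_exists i.
have [<-|/andP[_]] := support bV; first by exists i.
case/exists_inP=> i' i'b /exists_inP[j ja i'j]; exists j => //.
move: i'b; rewrite (mem_vclass _ bV ib) => /andP[ii' _].
exact: connect_trans i'j.
Qed.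

(** Every class equals or precedes [a], so [j] leads back to [a] and is strongly connected with
    [i]. *)
Lemma class_absorbing i j : i \in a -> arrow F i j -> j \in a.
Proof.
move=> ia ij; have [b bV jb] := vclass_exists j.
have [<-//|/andP[_ /exists_inP[j' j'b /exists_inP[i' i'a j'i']]]] := support bV.
move: j'b i'a; rewrite (mem_vclass _ bV jb) (mem_vclass _ aV ia).
move=> /andP[jj' _] /andP[_ i'i]; rewrite (mem_vclass _ aV ia).
rewrite (connect1 ij); apply: connect_trans i'i.
exact: connect_trans j'i'.
Qed.

Lemma class_forward (x : bpath F) n m :
  (x n).2 \in a -> (x (n + m)%N).2 \in a.
Proof.
elim: m => [|m IHm xa]; first by rewrite addn0.
rewrite addnS; apply: class_absorbing (IHm xa) _.
by have [_ xS] := bpathP x; apply: leq_trans (xS (n + m)%N).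
Qed.

End VertexClasses.

(** * Decomposition of a measure along the edges of one level *)

Section EdgeSum.
Variables (K : nat) (F : 'M[nat]_K) (x0 : bpath F) (R : realType).
Variable mu : {measure set (borelType x0) -> \bar R}.
Implicit Types (x y : bpath F) (A : set (bpath F)).

Lemma clopen_coord n (P : edge K -> Prop) :
  clopen [set x : bpath F | P (x n)].
Proof.
apply: (@determined_clopen _ _ n.+1) => x Px y xy.
by rewrite /= (xy n).
Qed.

Lemma measure_edge_sum A n : borel_set A ->
  mu A = (\sum_(e <- undup (edge_seq F)) mu (A `&` [set y | y n = e]))%E.
Proof.
move=> hA; suff H l : uniq l -> mu (A `&` [set y | y n \in l]) =
    (\sum_(e <- l) mu (A `&` [set y | y n = e]))%E.
  rewrite -H ?undup_uniq //; congr (mu _); apply/seteqP; split=> [y Ay|y []//].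
  by split; rewrite //= mem_undup edge_seqP.
elim: l => [_|e l IHl /= /andP[el ul]].
  rewrite big_nil (_ : _ `&` _ = set0) ?measure0 //.
  by apply/seteqP; split=> // y [].
rewrite big_cons -IHl // -borel_measureU.
- congr (mu _); rewrite -setIUr; congr (_ `&` _); apply/seteqP; split=> y /=.
    by rewrite inE => /orP[/eqP|]; [left|right].
  by rewrite inE => -[->|->]; rewrite ?eqxx ?orbT.
- exact: borel_setI hA (borel_clopen (clopen_coord n (eq^~ e))).
- exact: borel_setI hA (borel_clopen (clopen_coord n (fun d => d \in l))).
- by apply/seteqP; split=> // y [[_ /= ->] [_ /=]]; apply/negP.
Qed.
End EdgeSum.

Lemma geometric_small (R : realType) (lambda c e : R) : 1 < lambda -> 0 < e ->
  exists n, forall m, (n <= m)%N -> c / lambda ^+ m < e.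
Proof.
move=> l1 e0; have l0 : 0 < lambda by apply: lt_trans l1.
have li : `|lambda^-1| < 1 by rewrite ger0_norm ?invr_ge0 ?ltW // invf_lt1.
have /cvgrPdist_lt/(_ e e0)[n _ hn] := cvg_geometric c li.
exists n => m nm; have := hn m nm.
rewrite /geometric /= sub0r normrN exprVn; apply: le_lt_trans.
exact: ler_norm.
Qed.

(** * The measure of a class: finiteness of cylinders, fullness, null sets *)

Section ClassMeasure.
Variables (R : realType) (K : nat) (F : 'M[nat]_K) (x0 : bpath F).
Variable mu : {measure set (borelType x0) -> \bar R}.
Variables (a : {set 'I_K}) (lambda : R).
Implicit Types (x y z : bpath F) (A : set (bpath F)).
Hypothesis F_out : forall j, exists i, F i j != 0%N.
Hypothesis support : forall b, b \in vclasses F -> b = a \/ class_prec F b a.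
Hypothesis hmu : class_measure a lambda mu.

Let aV : a \in vclasses F. Proof. by case: hmu. Qed.
Let lambda1 : 1 < lambda. Proof. by case: hmu. Qed.

Let lambda_gt0 : 0 < lambda. Proof. exact: lt_trans lambda1. Qed.

Local Notation S := (Bf_vertices a mu).

Let clopen_in n : clopen [set x : bpath F | (x n).2 \in a].
Proof. exact: clopen_coord n (fun e => e.2 \in a). Qed.

(** The bound [c] is the sum of the eigenvector's entries. Being uniform in the vertex, it makes
    cylinders ending in [a] shrink geometrically. *)
Lemma class_pcyl : exists c : R, forall x n, (x n).2 \in a ->
  exists v, [/\ 0 < v, v <= c & mu (pcyl x n.+1) = (v / lambda ^+ n)%:E].
Proof.
have [_ _ _ _ [xi [xi0 _] hxi]] := hmu; exists (\sum_i xi i 0) => x n xa.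
exists (xi (enum_rank_in xa (x n).2) 0); split=> //.
  rewrite (bigD1 (enum_rank_in xa (x n).2)) //= lerDl sumr_ge0 // => i _.
  exact: ltW.
rewrite -cylinder_mkseq (hxi (enum_rank_in xa (x n).2)) ?size_mkseq //.
rewrite enum_rankK_in //.
exact: fpath_mkseq.
Qed.

Lemma class_paths_bigcup N :
  class_paths F a = \bigcup_m [set x | (x (N + m)%N).2 \in a].
Proof.
apply/seteqP; split=> [x [n hn]|x [m _ /= xm]].
  by exists n => //=; apply/hn/leq_addl.
exists (N + m)%N => k /subnKC <-; exact: class_forward.
Qed.

Lemma borel_class_paths : borel_set (class_paths F a).
Proof.
rewrite (class_paths_bigcup 0); apply: borel_bigcup => m.
exact: borel_clopen (clopen_in (0 + m)).
Qed.

(** [mu] is carried by the paths eventually in [a]. As [a] is never left, the sets of paths already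
    in [a] at a given level increase to these, and continuity from below applies. *)
Lemma measure_le_approx A N (c : \bar R) : borel_set A ->
    (forall m, mu (A `&` [set x | (x (N + m)%N).2 \in a]) <= c)%E ->
  (mu A <= c)%E.
Proof.
move=> hA Ac; have [_ _ _ mu0 _] := hmu.
have -> : mu A = mu (A `&` class_paths F a).
  have -> : mu A = mu ((A `&` class_paths F a) `|` (A `&` ~` class_paths F a)).
    by rewrite -setIUr setUv setIT.
  have bC := borel_setC borel_class_paths.
  rewrite borel_measureU; last by rewrite setIACA setICr setI0.
  - rewrite [X in (_ + X)%E](_ : _ = 0%E) ?adde0 //.
    by apply: borel_measure_null mu0 => //; apply: borel_setI.
  - exact: borel_setI hA borel_class_paths.
  - exact: borel_setI.
rewrite (class_paths_bigcup N) setI_bigcupr.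
apply: borel_measure_bigcup_le => // m.
  exact: borel_setI hA (borel_clopen (clopen_in (N + m))).
move=> x [Ax /= xa]; split=> //=; rewrite addnS -addn1.
exact: class_forward.
Qed.

(* Both sides depend on the vertex only, because the extensions of [x] and [y]
   beyond it are the same. *)
Lemma class_scaling m x n y k : (x n).2 = (y k).2 ->
  ((lambda ^+ n)%:E * mu (pcyl x n.+1 `&` [set z | (z (n + m)%N).2 \in a]) =
   (lambda ^+ k)%:E * mu (pcyl y k.+1 `&` [set z | (z (k + m)%N).2 \in a]))%E.
Proof.
elim: m x n y k => [|m IHm] x n y k exy.
  rewrite !addn0.
  have E z l : pcyl z l.+1 `&` [set w | (w l).2 \in a] =
      if (z l).2 \in a then pcyl z l.+1 else set0.
    case: ifPn => za; apply/seteqP; split=> w.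
    - by move=> [].
    - by move=> zw; split=> //=; rewrite (zw l).
    - by move=> [zw /=]; rewrite (zw l) // (negbTE za).
    - by [].
  rewrite !E -exy; case: ifPn => xa; last by rewrite !measure0 !mule0.
  have [_ _ _ _ [xi _ hxi]] := hmu.
  have M z l : (z l).2 = (x n).2 -> ((lambda ^+ l)%:E * mu (pcyl z l.+1))%E =
      (xi (enum_rank_in xa (x n).2) 0)%:E.
    move=> ez; rewrite -cylinder_mkseq (hxi (enum_rank_in xa (x n).2)).
      by rewrite size_mkseq -EFinM mulrCA divff ?mulr1 // expf_neq0 // gt_eqF.
    by rewrite enum_rankK_in // -ez; apply: fpath_mkseq.
  by rewrite (M x n erefl) (M y k (esym exy)).
have bX z l d : borel_set (pcyl z l.+1 `&` [set w | (w d).2 \in a]).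
  exact: borel_setI (borel_clopen (clopen_pcyl z l.+1))
    (borel_clopen (clopen_in d)).
(* Split both sides by the next edge: the same edges leave the common vertex, and each leads to an
   instance of the induction hypothesis. *)
rewrite (measure_edge_sum mu n.+1 (bX x n _)).
rewrite (measure_edge_sum mu k.+1 (bX y k _)).
rewrite !ge0_sume_distrr; try by move=> *; apply: measure_ge0.
apply: eq_bigr => e _.
have E z z' l : (forall j, (j <= l)%N -> z' j = z j) -> z' l.+1 = e ->
      pcyl z l.+1 `&` [set w | (w (l + m.+1)%N).2 \in a]
        `&` [set w | w l.+1 = e] =
      pcyl z' l.+2 `&` [set w | (w (l.+1 + m)%N).2 \in a].
  move=> zz' z'e; rewrite addSnnS.
  apply/seteqP; split=> [w [[zw wa] /= we]|w [zw wa]].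
    split=> // j; rewrite ltnS leq_eqVlt => /orP[/eqP ->|jl].
      by rewrite we.
    by rewrite zw // zz'.
  split; last by rewrite /= zw.
  by split=> // j jl; rewrite zw ?zz' // ltnW.
have N z l : ~~ follows F (z l) e ->
      pcyl z l.+1 `&` [set w | (w (l + m.+1)%N).2 \in a]
        `&` [set w | w l.+1 = e] = set0.
  move=> /negP ze; apply/seteqP; split=> // w [[zw _] /= we]; apply: ze.
  by rewrite -we -zw //; have [_] := bpathP w; apply.
have [xe|xe] := boolP (follows F (x n) e); last first.
  rewrite (N x n xe) (N y k) ?measure0 ?mule0 //.
  by move: xe; rewrite /follows exy.
have ye : follows F (y k) e by move: xe; rewrite /follows exy.
have [x' [xx' x'e]] := bpath_step F_out xe.
have [y' [yy' y'e]] := bpath_step F_out ye.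
rewrite (E _ _ _ xx' x'e) (E _ _ _ yy' y'e).
have exy' : (x' n.+1).2 = (y' k.+1).2 by rewrite x'e y'e.
(* Both paths are one level longer here, so each side carries one surplus factor [lambda]. *)
have /(congr1 (fun r => ((lambda^-1)%:E * r)%E)) := IHm x' n.+1 y' k.+1 exy'.
by rewrite !muleA -!EFinM !exprS !mulKf // gt_eqF.
Qed.

(** Invariance compares only cylinders on the same level. Across levels, the approximations from
    inside scale by a power of [lambda], which bounds one measure by a finite multiple of the
    other. *)
Lemma class_finite_level x n y k : (x n).2 = (y k).2 ->
  (mu (pcyl x n.+1) < +oo -> mu (pcyl y k.+1) < +oo)%E.
Proof.
move=> exy xfin.
have bX d : borel_set (pcyl x n.+1 `&` [set w | (w d).2 \in a]).
  exact: borel_setI (borel_clopen (clopen_pcyl x n.+1))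
    (borel_clopen (clopen_in d)).
apply: (@le_lt_trans _ _
    ((lambda ^+ k)^-1%:E * ((lambda ^+ n)%:E * mu (pcyl x n.+1)))%E).
  apply: (@measure_le_approx _ k) => [|m].
    exact: borel_clopen (clopen_pcyl y k.+1).
  rewrite -[leLHS]mul1e -(@mulVf _ (lambda ^+ k)) ?expf_neq0 ?gt_eqF //.
  rewrite EFinM -muleA -(class_scaling m exy).
  rewrite lee_pmul2l ?fin_numE //; last first.
    by rewrite lte_fin invr_gt0 exprn_gt0.
  rewrite lee_pmul2l ?fin_numE ?lte_fin ?exprn_gt0 //.
  by apply: borel_measure_le => //; exact: borel_clopen (clopen_pcyl x n.+1).
have xf : mu (pcyl x n.+1) \is a fin_num by rewrite ge0_fin_numE ?measure_ge0.
by rewrite ltey_eq !fin_numM.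
Qed.

(** For the converse, from the end of [x] every vertex of its class is reached by extending [x].
    This gives a cylinder inside one of finite measure, and finiteness passes to all levels by
    [class_finite_level]. *)
Lemma Bf_vertices_finite x n :
  ((x n).2 \in S) = (mu (pcyl x n.+1) < +oo)%E.
Proof.
apply/idP/idP.
  rewrite finset.in_setU => /orP[xa|].
    by have [c /(_ x n xa)[v [_ _ ->]]] := class_pcyl; rewrite ltry.
  case/finset.bigcupP=> b /andP[bV /andP[_ /asboolP fb]] xb.
  by have := fb _ _ xb (fpath_mkseq x n); rewrite cylinder_mkseq.
move=> xfin; have [b bV xb] := vclass_exists F (x n).2.
rewrite finset.in_setU; have [<-|ba] := support bV; first by rewrite xb.
apply/orP; right; apply/finset.bigcupP; exists b; rewrite // bV ba /=.
apply/asboolP => i s ib /(fpath_bpath F_out)[y [k [-> yi]]].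
move: ib; rewrite (mem_vclass _ bV xb) => /andP[xi _].
have [z [m [zx zi]]] := bpath_connect F_out xi.
rewrite cylinder_mkseq; apply: (@class_finite_level z (n + m)%N).
  by rewrite zi yi.
apply: le_lt_trans xfin; apply: borel_measure_le.
- exact: borel_clopen (clopen_pcyl _ _).
- exact: borel_clopen (clopen_pcyl _ _).
- by move=> w zw j jn; rewrite zw ?zx // ltnS (leq_trans _ (leq_addr _ _)).
Qed.

Lemma Bf_vertices_forward x n : (x n).2 \in S -> (x n.+1).2 \in S.
Proof.
rewrite !Bf_vertices_finite; apply: le_lt_trans; apply: borel_measure_le.
- exact: borel_clopen (clopen_pcyl _ _).
- exact: borel_clopen (clopen_pcyl _ _).
- exact: pcyl_sub.
Qed.

(** Every vertex leads to [a], so each cylinder contains one ending in [a], which has positive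
    measure. *)
Lemma class_full : full_measure (T := bpath F) mu.
Proof.
move=> U oU [x Ux]; have /open_pcylP/(_ x Ux)[n xU] := oU.
have [j ja xj] := connect_to_class support (x n).2.
have [y [m [yx yj]]] := bpath_connect F_out xj.
have [c /(_ y (n + m)%N)] := class_pcyl; rewrite yj => /(_ ja)[v [v0 _ ev]].
apply: (@lt_le_trans _ _ (mu (pcyl y (n + m).+1))).
  by rewrite ev lte_fin divr_gt0 // exprn_gt0.
apply: borel_measure_le; first exact: borel_clopen (clopen_pcyl _ _).
  exact: borel_open.
apply: subset_trans xU => w yw k /ltnW kn.
by rewrite yw ?yx // ltnS (leq_trans kn) ?leq_addr.
Qed.

Lemma borel_point x : borel_set [set x].
Proof.
rewrite -[[set x]]setCK; apply: borel_setC; apply: borel_open.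
apply/open_pcylP => y yx; apply: contrapT => /forallNP H; apply: yx.
apply: bpath_ext => k; apply: contrapT => yxk; apply: (H k.+1) => z yz zx.
by apply: yxk; rewrite -zx yz.
Qed.

(** A point outside [class_paths F a] lies in a null set; any other point has cylinders of
    geometrically decreasing measure. *)
Lemma class_null_points : null_points (T := bpath F) mu.
Proof.
move=> x; have [_ _ _ mu0 _] := hmu.
have [[n xa]|xa] := pselect (class_paths F a x); last first.
  apply: borel_measure_null mu0; first exact: borel_point.
    exact: borel_setC borel_class_paths.
  by move=> _ ->.
have [c hc] := class_pcyl.
have le k : (n <= k)%N -> (mu [set x] <= (c / lambda ^+ k)%:E)%E.
  move=> /xa/hc[v [_ vc ev]]; apply: (@le_trans _ _ (mu (pcyl x k.+1))).
    apply: borel_measure_le; first exact: borel_point.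
      exact: borel_clopen (clopen_pcyl _ _).
    by move=> _ ->.
  by rewrite ev lee_fin ler_pM2r // invr_gt0 exprn_gt0.
apply/eqP; rewrite eq_le measure_ge0 andbT; apply/lee_addgt0Pr => e e0.
have [m hm] := geometric_small c lambda1 e0.
rewrite add0e; apply: le_trans (le _ (leq_maxl n m)) _.
by rewrite lee_fin ltW // hm // leq_maxr.
Qed.

(** A path that enters [a] has a cylinder of finite measure, so defective points lie in the null
    complement of [class_paths F a]. *)
Lemma class_defective : mu (defective_set (T := bpath F) mu) = 0%E.
Proof.
have [_ _ _ mu0 _] := hmu; apply: borel_measure_null mu0.
- apply: borel_closed; rewrite -openC; apply/open_pcylP => x /existsNP[U].
  move=> /not_implyP[cU /not_implyP[Ux mUx]].
  have [n xU] := (open_pcylP U).1 cU.1 x Ux.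
  by exists n => y xy dy; apply: mUx; apply: dy => //; apply: xU.
- exact: borel_setC borel_class_paths.
- move=> x dx [n /(_ n (leqnn n)) xa].
  have [c /(_ x n xa)[v [_ _ ev]]] := class_pcyl.
  by have := dx _ (clopen_pcyl x n.+1) (@pcyl_refl _ _ x _); rewrite ev.
Qed.

End ClassMeasure.

(** * Finite sums of measures of small clopen sets *)

Section ClopenSums.
Variables (R : realType) (T : topologicalType) (nu : set T -> \bar R).

(** The summands need not come from disjoint sets, so a sum may exceed the total mass of [nu]; [e]
    bounds the size of each piece. *)
Inductive clopen_sum (e : \bar R) : R -> Prop :=
| clopen_sum0 : clopen_sum e 0
| clopen_sumS A r : clopen A -> (nu A < e)%E -> clopen_sum e r ->
    clopen_sum e (fine (nu A) + r).

Lemma clopen_sumD e r s :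
  clopen_sum e r -> clopen_sum e s -> clopen_sum e (r + s).
Proof.
move=> + hs; elim=> [|A t cA Ae _ IHr]; first by rewrite add0r.
by rewrite -addrA; apply: clopen_sumS.
Qed.

Lemma clopen_sum1 e A : clopen A -> (nu A < e)%E -> clopen_sum e (fine (nu A)).
Proof.
move=> cA Ae; rewrite -[fine _]addr0.
by apply: clopen_sumS => //; apply: clopen_sum0.
Qed.

Hypothesis nu_ge0 : forall A, (0 <= nu A)%E.

Lemma clopen_sum_ge0 e r : clopen_sum e r -> 0 <= r.
Proof. by elim=> // A s _ _ _ s0; rewrite addr_ge0 // fine_ge0. Qed.

Lemma clopen_sum_le e e' r : (e <= e')%E -> clopen_sum e r -> clopen_sum e' r.
Proof.
move=> ee'; elim=> [|A s cA Ae _ IHs]; first exact: clopen_sum0.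
by apply: clopen_sumS => //; apply: lt_le_trans ee'.
Qed.

(** Pieces smaller than [q - p] cannot jump over the interval from [p] to [q]: dropping them one at
    a time from a sum above [p], the last sum still above [p] is below [q]. *)
Lemma clopen_sum_split (p q h : R) : p < q -> p < h -> 0 < q ->
    clopen_sum (q - p)%:E h ->
  exists r s, [/\ clopen_sum +oo r, clopen_sum +oo s, h = r + s & p < r < q].
Proof.
move=> pq ph q0 hh; elim: hh ph => [p0|A t cA Ae ht IHt pt].
  by exists 0, 0; split; rewrite ?addr0 ?p0 //; apply: clopen_sum0.
have Afin : (nu A < +oo)%E by apply: lt_le_trans Ae (leey _).
have ht' : clopen_sum +oo t by apply: clopen_sum_le ht; apply: leey.
have [/IHt[r [s [hr hs -> rpq]]]|tp] := ltP p t.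
  exists r, (fine (nu A) + s); split=> //; last by rewrite addrCA.
  exact: clopen_sumS.
exists (fine (nu A) + t), 0; split; rewrite ?addr0 //.
- exact: clopen_sumS.
- exact: clopen_sum0.
- rewrite pt; suff : fine (nu A) < q - p by lra.
  by rewrite -lte_fin fineK // ge0_fin_numE.
Qed.

End ClopenSums.

Section ClopenBorel.
Variables (T : topologicalType) (x0 : T) (R : realType).
Variable mu : {measure set (borelType x0) -> \bar R}.
Implicit Types U V W : set T.

Lemma clopenD U V : clopen U -> clopen V -> clopen (U `\` V).
Proof.
by move=> cU cV; rewrite setDE; apply: clopenI => //; apply: clopenC.
Qed.

Lemma clopen_measureU U V : clopen U -> clopen V -> U `&` V = set0 ->
  mu (U `|` V) = (mu U + mu V)%E.
Proof. by move=> /borel_clopen bU /borel_clopen bV; apply: borel_measureU. Qed.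

Lemma clopen_measureD W V : clopen W -> clopen V -> W `<=` V ->
  mu V = (mu W + mu (V `\` W))%E.
Proof.
move=> cW cV WV; rewrite -clopen_measureU ?setDIK //; last exact: clopenD.
by rewrite setDUK.
Qed.

Lemma clopen_sum_subset V h :
    (forall U V, clopen U -> clopen V -> (mu U < mu V)%E ->
      exists W, [/\ clopen W, W `<=` V & mu W = mu U]) ->
    clopen V -> clopen_sum mu +oo h -> (h%:E < mu V)%E ->
  exists W, [/\ clopen W, W `<=` V & mu W = h%:E].
Proof.
move=> sub cV hh; elim: hh V cV => [V cV _|A r cA Afin hr IHr V cV].
  exists set0; split; rewrite ?measure0 //; exact: clopen0.
have Af : mu A \is a fin_num by rewrite ge0_fin_numE ?measure_ge0.
rewrite EFinD fineK // => hV.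
have [|W [cW WV eW]] := sub A V cA cV.
  by apply: le_lt_trans hV; rewrite leeDl // lee_fin (clopen_sum_ge0 _ hr).
move: hV; rewrite (clopen_measureD cW cV WV) eW lteD2lE // => hV.
(* The remaining pieces are placed in what the first one leaves of [V]. *)
have [W' [cW' W'V eW']] := IHr _ (clopenD cV cW) hV.
exists (W `|` W'); split.
- exact: clopenU.
- by move=> x [/WV//|/W'V[]].
- rewrite clopen_measureU ?eW ?eW' //.
  by apply/seteqP; split=> // x [Wx /W'V[]].
Qed.

End ClopenBorel.

(** Each piece is cut into cylinders of length at least [n], all of measure below [e]. *)
Lemma clopen_sum_refine (R : realType) (K : nat) (F : 'M[nat]_K)
    (x0 : bpath F) (mu : {measure set (borelType x0) -> \bar R})
    (e : \bar R) n h :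
    (forall x, (mu (pcyl x n) < e)%E) ->
  clopen_sum (T := bpath F) mu +oo h -> clopen_sum (T := bpath F) mu e h.
Proof.
move=> mue; elim=> [|A r cA Afin _ IHr]; first exact: clopen_sum0.
apply: clopen_sumD => //; have [N AN] := clopen_determined cA.
pose P (B : set (bpath F)) := [/\ clopen B, (mu B < +oo)%E &
  clopen_sum (T := bpath F) mu e (fine (mu B))].
suff [] : P A by [].
apply: (@determined_ind _ _ P A (maxn N n)).
- exact: determined_leq (leq_maxl _ _) AN.
- rewrite /P measure0; split; rewrite ?ltry //; first exact: clopen0.
  exact: clopen_sum0.
- move=> B C BC [cB Bfin hB] [cC Cfin hC]; split; first exact: clopenU.
    by rewrite clopen_measureU // lte_add_pinfty.
  rewrite clopen_measureU // fineD ?ge0_fin_numE ?measure_ge0 //.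
  exact: clopen_sumD.
- move=> x _; have xn : (mu (pcyl x (maxn N n)) < e)%E.
    apply: le_lt_trans (mue x); apply: borel_measure_le.
    + exact: borel_clopen (clopen_pcyl _ _).
    + exact: borel_clopen (clopen_pcyl _ _).
    + exact/pcyl_sub/leq_maxr.
  split; first exact: clopen_pcyl.
    by apply: lt_le_trans xn (leey _).
  by apply: clopen_sum1 => //; apply: clopen_pcyl.
Qed.

(** * Goodness passed between [mu] and [muf] *)

Section FiniteSubdiagram.
Variables (R : realType) (K : nat) (F : 'M[nat]_K).
Hypothesis F_out : forall j, exists i, F i j != 0%N.
Variables (x0 : bpath F) (mu : {measure set (borelType x0) -> \bar R}).
Variables (a : {set 'I_K}) (lambda : R).
Hypothesis hmu : class_measure a lambda mu.
Hypothesis support : forall b, b \in vclasses F -> b = a \/ class_prec F b a.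

Local Notation S := (Bf_vertices a mu).
Local Notation Ff := (restrict_mx F S).
Local Notation incl := (@subdiagram_incl K F S).

Variable xf0 : bpath Ff.
Variable muf : probability (borelType xf0) R.
Variable v : 'cV[R]_#|S|.
Hypothesis hmuf : finite_measure_of lambda v muf.
Hypothesis mu_muf : forall A : set (bpath Ff),
  borel_set A -> mu (incl @` A) = muf A.

Let lambda1 : 1 < lambda. Proof. by case: hmu. Qed.
Let mu_inv : invariant_measure mu. Proof. by case: hmu. Qed.
Let S_forward := Bf_vertices_forward F_out support hmu.

Lemma good_restrict : good (T := bpath F) mu -> good (T := bpath Ff) muf.
Proof.
move=> [full null _ sub]; split.
- move=> U oU [y Uy]; rewrite -mu_muf; last exact: borel_open.
  by apply: full; [apply: incl_open|exists (incl y), y].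
- move=> y; rewrite -mu_muf ?image_set1; first exact: null.
  exact: borel_point.
- by left; apply: probability_setT.
- move=> U V cU cV.
  rewrite -(mu_muf (borel_clopen cU)) -(mu_muf (borel_clopen cV)) => UV.
  have cU' := incl_clopen S_forward cU; have cV' := incl_clopen S_forward cV.
  have [W [cW WV eW]] := sub _ _ cU' cV' UV.
  have cW' := incl_preimage_clopen S cW.
  (* [W] lies in the image of [V], so it is the image of its own preimage and no measure is lost. *)
  exists (incl @^-1` W); split=> //.
    by move=> y /WV[z Vz /incl_inj <-].
  rewrite -(mu_muf (borel_clopen cW')) -eW; congr (mu _).
  apply/seteqP; split=> [_ [y Wy <-] //|x Wx].
  by have [y _ eyx] := WV x Wx; exists y => //; rewrite /= eyx.
Qed.

Lemma muf_small e :
  0 < e -> exists n, forall y : bpath Ff, (muf (pcyl y n) < e%:E)%E.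
Proof.
move=> e0; have [n hn] := geometric_small 1 lambda1 e0; exists n.+1 => y.
have [[v0 _] v1 _ _ hv] := hmuf.
rewrite -cylinder_mkseq (hv (y n).2) ?fpath_mkseq // size_mkseq lte_fin.
apply: le_lt_trans (hn n (leqnn n)).
rewrite ler_pM2r ?invr_gt0 ?exprn_gt0 ?(lt_trans ltr01) // -v1.
by rewrite (bigD1 (y n).2) //= lerDl sumr_ge0 // => i _; apply: ltW.
Qed.

Lemma pcyl_muf (x : bpath F) n (y : bpath Ff) : (x n).2 = (incl y n).2 ->
  mu (pcyl x n.+1) = muf (pcyl y n.+1).
Proof.
move=> exy; rewrite -mu_muf; last exact: borel_clopen (clopen_pcyl _ _).
by rewrite (incl_pcyl S_forward); apply: invariant_pcyl.
Qed.

Lemma finite_clopen_sum (U : set (bpath F)) : clopen U -> (mu U < +oo)%E ->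
  clopen_sum (T := bpath Ff) muf +oo (fine (mu U)).
Proof.
move=> cU Ufin; have [N UN] := clopen_determined cU.
have [n0 hn0] := subdiagram_reach S_forward.
pose P (B : set (bpath F)) := clopen B /\
  ((mu B < +oo)%E -> clopen_sum (T := bpath Ff) muf +oo (fine (mu B))).
suff [_] : P U by apply.
(* On level [N.+1] the cylinders inside [U] have finite measure, so end in [S]; [n0] levels later
   their end vertices are also reached by paths of the subdiagram. *)
apply: (@determined_ind _ _ P U (N + n0).+1).
- by apply: determined_leq UN; rewrite leqW // leq_addr.
- by split=> [|_]; [exact: clopen0|rewrite measure0; exact: clopen_sum0].
- move=> B C BC [cB hB] [cC hC]; split; first exact: clopenU.
  rewrite clopen_measureU // => BCfin.
  have Bfin : (mu B < +oo)%E by apply: le_lt_trans BCfin; rewrite leeDl.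
  have Cfin : (mu C < +oo)%E by apply: le_lt_trans BCfin; rewrite leeDr.
  rewrite fineD ?ge0_fin_numE ?measure_ge0 //.
  by apply: clopen_sumD; [apply: hB|apply: hC].
- move=> x Ux; split=> [|xfin]; first exact: clopen_pcyl.
  have xS : (x N).2 \in S.
    rewrite (Bf_vertices_finite F_out support hmu); apply: le_lt_trans Ufin.
    apply: borel_measure_le; first exact: borel_clopen (clopen_pcyl _ _).
      exact: borel_clopen.
    exact: subset_trans (pcyl_sub (leqnSn N)) (UN x Ux).
  have [y ey] := hn0 x N n0 (N + n0)%N (leqnn _) xS.
  rewrite (pcyl_muf (esym ey)) in xfin *.
  by apply: clopen_sum1 => //; apply: clopen_pcyl.
Qed.

(** The subset condition of goodness with a sum as target. Unlike a clopen set, a sum can be cut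
    into parts for different cylinders. *)
Definition fills (V : set (bpath F)) := forall h,
  clopen_sum (T := bpath Ff) muf +oo h -> (h%:E < mu V)%E ->
  exists W, [/\ clopen W, W `<=` V & mu W = h%:E].

Hypothesis muf_good : good (T := bpath Ff) muf.

Lemma pcyl_fills (x : bpath F) n (y : bpath Ff) : (x n).2 = (incl y n).2 ->
  fills (pcyl x n.+1).
Proof.
move=> exy h hh; rewrite (pcyl_muf exy) => hy; have [_ _ _ sub] := muf_good.
have [W [cW Wy eW]] := clopen_sum_subset sub (clopen_pcyl y n.+1) hh hy.
have [||W' [cW' W'x eW']] := invariant_transport mu_inv (A := incl @` W) exy.
- by rewrite -(incl_pcyl S_forward); apply: image_subset.
- exact: incl_clopen.
- by exists W'; split=> //; rewrite eW' mu_muf //; apply: borel_clopen.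
Qed.

Lemma fillsU (U V : set (bpath F)) : clopen U -> clopen V -> U `&` V = set0 ->
    (mu U < +oo)%E -> (mu V < +oo)%E ->
  fills U -> fills V -> fills (U `|` V).
Proof.
move=> cU cV UV Ufin Vfin fU fV h hh; rewrite clopen_measureU // => hUV.
have [/(fU h hh)[W [cW WU eW]]|Uh] := ltP h%:E (mu U).
  by exists W; split=> // x /WU; left.
have [/(fV h hh)[W [cW WV eW]]|Vh] := ltP h%:E (mu V).
  by exists W; split=> // x /WV; right.
have eU : mu U = (fine (mu U))%:E by rewrite fineK // ge0_fin_numE.
have eV : mu V = (fine (mu V))%:E by rewrite fineK // ge0_fin_numE.
move: Uh Vh hUV; rewrite eU eV -EFinD !lee_fin lte_fin => Uh Vh hUV.
(* A splitting [h = r + s] with [r] below [mu U] and [s] below [mu V] means that [r] lies strictly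
   between [p] and [q]. The cases settled above leave both measures positive, whence [p < h] and
   [0 < q]. *)
pose p := h - fine (mu V); pose q := fine (mu U).
have [n hn] := @muf_small (q - p) ltac:(rewrite /p /q; lra).
have [||||r [s [hr hs ers /andP[pr rq]]]] :=
    @clopen_sum_split _ _ muf (fun A => measure_ge0 muf A) p q h.
- by rewrite /p /q; lra.
- by rewrite /p; lra.
- by rewrite /q; lra.
- exact: clopen_sum_refine hn hh.
have [|W [cW WU eW]] := fU r hr; first by rewrite eU lte_fin.
have [|W' [cW' W'V eW']] := fV s hs.
  by rewrite eV lte_fin; move: pr; rewrite /p; lra.
exists (W `|` W'); split; first exact: clopenU.
  exact: setUSS.
rewrite clopen_measureU ?eW ?eW' -?EFinD ?ers //.
by apply: subsetI_eq0 UV.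
Qed.

Lemma clopen_fills (V : set (bpath F)) : clopen V -> fills V.
Proof.
move=> cV h hh hV; have [N VN] := clopen_determined cV.
(* The part of [V] in [a] by a late enough level exceeds [h] and, unlike [V], is sure to have finite
   measure. *)
have [m hm] : exists m, (h%:E < mu (V `&` [set x | (x (N + m)%N).2 \in a]))%E.
  apply: contrapT => /forallNP H.
  suff : (mu V <= h%:E)%E by rewrite leNgt hV.
  apply: (measure_le_approx (N := N) support hmu (borel_clopen cV)) => m.
  by rewrite leNgt; apply/negP/H.
have [n0 hn0] := subdiagram_reach S_forward.
(* The extra [n0] levels make every end vertex one that the subdiagram also reaches on level
   [M.+1]. *)
set V' := V `&` _ in hm; pose M := (N + m + n0)%N.
have V'V : V' `<=` V by move=> x [].
have V'M : determined M.+1 V'.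
  apply: determined_setI.
    by apply: determined_leq VN; rewrite /M; lia.
  apply: (@determined_leq _ _ (N + m).+1); first by rewrite /M; lia.
  by move=> x xa y xy; rewrite /= (xy (N + m)%N).
have [_ _ fV'] : [/\ clopen V', (mu V' < +oo)%E & fills V'].
  apply: (@determined_ind _ _
    (fun B => [/\ clopen B, (mu B < +oo)%E & fills B]) V' M.+1 V'M).
  - split; [exact: clopen0|by rewrite measure0 ltry|move=> r hr].
    rewrite measure0 lte_fin ltNge.
    by rewrite (clopen_sum_ge0 (fun A => measure_ge0 muf A) hr).
  - move=> B C BC [cB Bfin fB] [cC Cfin fC]; split; first exact: clopenU.
      by rewrite clopen_measureU // lte_add_pinfty.
    exact: fillsU.
  - move=> x [Vx xa].
    have xM : (x M).2 \in a by have [aV _ _ _ _] := hmu; exact: class_forward.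
    split; first exact: clopen_pcyl.
      by have [c /(_ x M xM)[w [_ _ ->]]] := class_pcyl hmu; rewrite ltry.
    have xS : (x (N + m)%N).2 \in S by rewrite finset.in_setU xa.
    have [y ey] := hn0 x (N + m)%N n0 M (leqnn _) xS.
    exact: pcyl_fills (esym ey).
have [W [cW WV' eW]] := fV' h hh hm.
by exists W; split=> //; apply: subset_trans V'V.
Qed.

Lemma good_extend : mu setT = +oo%E -> good (T := bpath F) mu.
Proof.
move=> muT; split.
- exact: class_full F_out support hmu.
- exact: class_null_points support hmu.
- by right; split=> //; apply: class_defective support hmu.
- move=> U V cU cV UV.
  have Ufin : (mu U < +oo)%E by apply: lt_le_trans UV (leey _).
  have eU : mu U = (fine (mu U))%:E by rewrite fineK // ge0_fin_numE.
  rewrite eU in UV *.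
  exact: (clopen_fills cV (finite_clopen_sum cU Ufin) UV).
Qed.

End FiniteSubdiagram.

Theorem theorem3p4 (R : realType) (K : nat) (F : 'M[nat]_K)
  (hF : stationary_diagram F)
  (x0 : bpath F)
  (mu : {measure set (borelType x0) -> \bar R})
  (a : {set 'I_K}) (lambda : R)
  (hmu : class_measure a lambda mu)
  (mu_ergodic : ergodic mu)
  (mu_infinite : mu setT = +oo%E)
  (mu_support : forall b, b \in vclasses F -> b = a \/ class_prec F b a)
  (xf0 : bpath (restrict_mx F (Bf_vertices a mu)))
  (muf : probability (borelType xf0) R)
  (x : 'cV[R]_#|Bf_vertices a mu|)
  (hmuf : finite_measure_of lambda x muf)
  (mu_normalized : forall A : set (bpath (restrict_mx F (Bf_vertices a mu))),
     borel_set A -> mu (@subdiagram_incl K F (Bf_vertices a mu) @` A) = muf A) :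
  good (T := bpath F) mu <->
  good (T := bpath (restrict_mx F (Bf_vertices a mu))) muf.
Proof.
have [_ F_out _ _] := hF; split.
  exact: (good_restrict F_out hmu mu_support mu_normalized).
move=> muf_good.
exact: (good_extend F_out hmu mu_support hmuf mu_normalized muf_good).
Qed.
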